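(* For any regular recursively generated graph $G_l=(V_l,E_l)$ with $l\ge1$, base graph $G_0=(V_0,E_0)=C_n$ and $\mathcal P=\{C_n\}$, $$\mathrm{diam}_{G_l}=\mathrm{diam}_{G_0}\left(\mathrm{diam}_{G_{l-1}}+2\right).$$
   Context: $\mathrm{dist}_G$ and $\mathrm{diam}_G$ are hop distance and diameter of a graph $G$. $C_n$ is the cycle with $n=2^m$ nodes, $n\ge4$. Edge substitution. Substituting an edge $(u,v)$ with respect to a graph $H$ means: delete the edge, add a fresh copy $G_{uv}=(V_{uv},E_{uv})$ of $H$ containing two nodes $w_{uv},w'_{uv}$ with $\mathrm{dist}_{G_{uv}}(w_{uv},w'_{uv})=\mathrm{diam}_H$, and add the edges $(u,w_{uv})$ and $(v,w'_{uv})$. Edge substitution of a graph substitutes all of its edges. Regular recursively generated graph (RRGG) with $G_0=H=C_n$, $\mathcal P=\{C_n\}$. $G_0=(V_0,E_0)=C_n$. Given $G_l=(V_l,E_l)$, every subgraph $\tilde G_l\subseteq G_l\setminus G_{l-1}$ (the part of $G_l$ induced on $V_l\setminus V_{l-1}$, with $V_{-1}=\emptyset$) isomorphic to $C_n$ has all its edges substituted with respect to $H=C_n$; the result is $G_{l+1}=(V_{l+1},E_{l+1})$. All other edges of $G_l$ (such as the connecting edges $(u,w_{uv})$) are left unchanged, and $V_l\subseteq V_{l+1}$. *)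

(* Defs.v *)
From mathcomp Require Import all_boot.

Set Implicit Arguments.
Unset Strict Implicit.
Unset Printing Implicit Defensive.

Record sgraph := SGraph {
  vertex :> finType;
  adj : rel vertex;
  adj_sym : symmetric adj;
  adj_irrefl : irreflexive adj }.

Notation "x -- y" := (adj x y) (at level 30, no associativity).

Definition edges (G : sgraph) : {set {set G}} :=
  [set [set x; y] | x in G, y in G & x -- y].

Definition walk (G : sgraph) (k : nat) (x y : G) : bool :=
  [exists p : k.-tuple G, path (@adj G) x p && (last x p == y)].

(* Two connected vertices are joined by a walk of length < #|G|, so the value *)
(* #|G|, which [find] returns when there is none, stands for infinity.        *)
Definition dist (G : sgraph) (x y : G) : nat :=
  find (fun k => walk k x y) (iota 0 #|G|).

Definition diam (G : sgraph) : nat := \max_(x : G) \max_(y : G) dist x y.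

(* The conjunct i != j only matters for n = 1, where it removes the loop.     *)
Definition cycle_adj n : rel 'I_n :=
  fun i j => (i != j) && ((j == ordS i) || (i == ordS j)).

Lemma cycle_adj_sym n : symmetric (@cycle_adj n).
Proof. by move=> i j; rewrite /cycle_adj eq_sym orbC. Qed.

Lemma cycle_adj_irrefl n : irreflexive (@cycle_adj n).
Proof. by move=> i; rewrite /cycle_adj eqxx. Qed.

Definition cycle_graph n : sgraph :=
  SGraph (@cycle_adj_sym n) (@cycle_adj_irrefl n).

Section EdgeSubstitution.
Variables (G H : sgraph) (S : {set {set G}}).

(* Simultaneous substitution of all the edges in S: one copy of H for each    *)
(* e in S, the copy being joined to each endpoint u of e by the single edge   *)
(* from u to the node [port e u] of that copy.                                *)
Variable port : {e : {set G} | e \in S} -> G -> H.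

Definition subst_vertex : finType := (G + {e : {set G} | e \in S} * H)%type.

Definition subst_adj : rel subst_vertex := fun a b =>
  match a, b with
  | inl u, inl v => (u -- v) && ([set u; v] \notin S)
  | inl u, inr (e, x) | inr (e, x), inl u => (u \in val e) && (x == port e u)
  | inr (e, x), inr (f, y) => (e == f) && (x -- y)
  end.

Lemma subst_adj_sym : symmetric subst_adj.
Proof.
case=> [u|[e x]] [v|[f y]] //=; first by rewrite adj_sym setUC.
by rewrite eq_sym adj_sym.
Qed.

Lemma subst_adj_irrefl : irreflexive subst_adj.
Proof. by case=> [u|[e x]] /=; rewrite adj_irrefl ?andbF. Qed.

Definition subst_edges : sgraph := SGraph subst_adj_sym subst_adj_irrefl.

(* For e = {u, v}, the nodes w_uv and w'_uv are [port e u] and [port e v].    *)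
Definition diametral_ports : Prop :=
  forall e u v, val e = [set u; v] -> dist (port e u) (port e v) = diam H.

End EdgeSubstitution.

(* (W, F) is a subgraph of the subgraph of G induced on A.                    *)
Definition is_subgraph (G : sgraph) (A W : {set G}) (F : {set {set G}}) : Prop :=
  [/\ W \subset A, F \subset edges G & forall e, e \in F -> e \subset W].

Definition subgraph_iso (G Q : sgraph) (W : {set G}) (F : {set {set G}}) : Prop :=
  exists f : Q -> G,
    [/\ injective f, f @: [set: Q] = W
      & forall x y, x -- y = ([set f x; f y] \in F)].

(* A stage is the graph G_l together with [fresh] = V_l \ V_(l-1).            *)
Record stage := Stage { stage_graph :> sgraph; fresh : {set stage_graph} }.

(* S is the set of all edges of the subgraphs of G_l \ G_(l-1) isomorphic to  *)
(* a member of P.                                                             *)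
Definition rrgg_step (H : sgraph) (P : sgraph -> Prop) (G G' : stage) : Prop :=
  exists (S : {set {set G}}) (port : {e : {set G} | e \in S} -> G -> H),
    [/\ forall e, e \in S <->
          exists (Q : sgraph) (W : {set G}) (F : {set {set G}}),
            [/\ P Q, is_subgraph (fresh G) W F, subgraph_iso Q W F & e \in F],
        diametral_ports port
      & G' = @Stage (subst_edges port) [set a | ~~ is_inl a]].

Definition rrgg (G0 H : sgraph) (P : sgraph -> Prop) (G : nat -> stage) : Prop :=
  G 0 = @Stage G0 [set: G0] /\ forall l, rrgg_step H P (G l) (G l.+1).

(* Main.v *)
(* Give the fresh edges of G_l the length w and all other edges the length 1. *)
(* Seen from V_l, substituting a fresh edge by a copy of C_n, h = n / 2, just *)
(* gives it the length h * w + 2, where w is the length of the edges of the   *)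
(* copy. The value D of the diameter is therefore that of the previous stage  *)
(* with w replaced by h * w + 2, which unrolls to h * w for C_n itself.       *)
(* Two certificates for D pass through a substitution. For the upper bound,   *)
(* any two vertices or fresh edges lie on a closed curve of length 2 * D:     *)
(* every node and edge of a copy lies on a geodesic between its two ports, so *)
(* a closed curve through e can be rerouted through any node or edge of the   *)
(* copy replacing e. For the lower bound, a Lipschitz potential varying by D  *)
(* extends to the copies.                                                     *)
Require Import Defs.
From mathcomp Require Import all_boot zify.

Set Implicit Arguments.
Unset Strict Implicit.
Unset Printing Implicit Defensive.

(** [rrgg_invariant] certifies, for stage [l] with fresh edges of length [w], the value [D_l(w)]:
    [h] times the [l]-th iterate of [f k = h * k + 2] at [w]. [round_cycle] and [stretched_cycle]
    give [D_0(w) = h * w]; [round_subst] and [stretched_subst] give [D_(l+1)(w) = D_l(f w)], which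
    adds the new [f] innermost. Peeling off the outermost [f] instead gives
    [D_(l+1)(w) = h * (D_l(w) + 2)]. At [w = 1] lengths are hop counts, so [diam_eq] turns this into
    the claim, [h] being the diameter of [C_n]. *)

(** * Walks, hop distance and pseudometrics *)

Section Distance.
Variable G : sgraph.
Implicit Types x y z : G.

Lemma walkP k x y :
  reflect (exists p, [/\ size p = k, path (@adj G) x p & last x p = y])
          (walk k x y).
Proof.
apply: (iffP existsP) => [[p /andP[px /eqP py]]|[p [/eqP sp px py]]].
  by exists p; rewrite size_tuple.
by exists (Tuple sp); rewrite px py eqxx.
Qed.

Lemma walk0 x : walk 0 x x.
Proof. by apply/walkP; exists [::]. Qed.

Lemma walk1 x y : x -- y -> walk 1 x y.
Proof. by move=> xy; apply/walkP; exists [:: y]; rewrite /= xy. Qed.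

Lemma walkD j k x y z : walk j x y -> walk k y z -> walk (j + k) x z.
Proof.
move=> /walkP[p [<- px py]] /walkP[q [<- qy qz]]; apply/walkP.
by exists (p ++ q); rewrite size_cat cat_path last_cat px py.
Qed.

Lemma walk_sym k x y : walk k x y -> walk k y x.
Proof.
move=> /walkP[p [<- + <-]]; elim: p x => [|z p IHp] x /=.
  by rewrite walk0.
move=> /andP[xz /IHp zp]; rewrite -addn1; apply: walkD zp _.
by apply: walk1; rewrite adj_sym.
Qed.

Lemma dist_le_card x y : dist x y <= #|G|.
Proof. by rewrite -[leqRHS](size_iota 0) find_size. Qed.

Lemma dist_le k x y : walk k x y -> dist x y <= k.
Proof.
move=> xy; have [kG|/(leq_trans (dist_le_card x y))//] := ltnP k #|G|.
rewrite leqNgt; apply/negP => /(before_find 0).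
by rewrite nth_iota // add0n xy.
Qed.

Lemma walk_dist x y : dist x y < #|G| -> walk (dist x y) x y.
Proof.
move=> dG; have := dG; rewrite -[ltnRHS](size_iota 0) -has_find.
by move=> /(nth_find 0); rewrite nth_iota.
Qed.

Definition pseudometric (w d : G -> G -> nat) : Prop :=
  [/\ forall x, d x x = 0, forall x y, d x y = d y x,
      forall x y z, d x z <= d x y + d y z
    & forall x y, x -- y -> d x y <= w x y].

(* The triangle inequality survives the value #|G| of dist for "infinity",    *)
(* since all the finite distances are smaller.                                *)
Lemma dist_pseudometric : pseudometric (fun _ _ => 1) (@dist G).
Proof.
split=> [x|x y|x y z|x y xy]; last exact/dist_le/walk1.
- by apply/eqP; rewrite -leqn0; apply/dist_le/walk0.
- have le (u v : G) : dist u v <= dist v u.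
    have [vu|/(leq_trans (dist_le_card u v))//] := ltnP (dist v u) #|G|.
    exact/dist_le/walk_sym/walk_dist.
  by apply/eqP; rewrite eqn_leq !le.
- have := dist_le_card x z.
  have [xy _|] := ltnP (dist x y) #|G|; last lia.
  have [yz|] := ltnP (dist y z) #|G|; last by have := dist_le_card x z; lia.
  by apply/dist_le/walkD; apply: walk_dist; first exact: xy.
Qed.

Lemma connect_dist x y : connect (@adj G) x y -> dist x y < #|G|.
Proof.
move=> /connectP[p /shortenP[q qx uq _] ->].
have := max_card (mem (x :: q)); rewrite (card_uniqP uq); apply: leq_ltn_trans.
by apply/dist_le/walkP; exists q.
Qed.

Lemma lipschitz_walk (phi : G -> nat) k x y :
  (forall u v, u -- v -> phi v <= phi u + 1) -> walk k x y ->
  phi y <= phi x + k.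
Proof.
move=> phi1 /walkP[p [<- + <-]]; elim: p x => [|z p IHp] x /=; first lia.
by move=> /andP[/phi1 xz /IHp]; lia.
Qed.

End Distance.

(** * Certificates for the weighted diameter *)

Definition fresh_edge (G : stage) (x y : G) : Prop :=
  [/\ x \in fresh G, y \in fresh G & x -- y].

Lemma fresh_edge_sym (G : stage) (x y : G) : fresh_edge x y -> fresh_edge y x.
Proof. by case=> fx fy xy; split; rewrite // adj_sym. Qed.

Definition edge_weight (G : stage) w (x y : G) : nat :=
  if (x \in fresh G) && (y \in fresh G) then w else 1.

(* A vertex is treated as a degenerate edge of length 0.                      *)
Definition segment (G : stage) w (x y : G) c : Prop :=
  x = y /\ c = 0 \/ fresh_edge x y /\ c = w.

(* The two vertices or edges xy and pq lie on a common closed curve of length *)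
(* at most 2 * D; the two cases are its two possible orientations. Since G is *)
(* only seen through pseudometrics d bounded on its edges, restricting d from *)
(* a substituted graph to the original vertices is all the induction needs.   *)
Definition round (G : stage) w D : Prop :=
  forall d, pseudometric (@edge_weight G w) d ->
  forall x y c p q c', segment w x y c -> segment w p q c' ->
  d x p + d y q + c + c' <= D.*2 \/ d x q + d y p + c + c' <= D.*2.

Definition stretched (G : stage) w D : Prop :=
  exists phi : G -> nat,
    (forall x y, x -- y -> phi y <= phi x + edge_weight w x y)
    /\ exists x y, phi x + D <= phi y.

Lemma round_le (G : stage) w D (d : G -> G -> nat) (x y : G) :
  round G w D -> pseudometric (@edge_weight G w) d -> d x y <= D.
Proof.
by move=> rG dP; have := rG d dP x x 0 y y 0 (or_introl (conj erefl erefl))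
  (or_introl (conj erefl erefl)); case; lia.
Qed.

Lemma edge_weight1 (G : stage) (x y : G) : edge_weight 1 x y = 1.
Proof. by rewrite /edge_weight if_same. Qed.

(** The pseudometric equal to [D.+1] between distinct components and 0 inside them would violate
    [round_le]. *)
Lemma round_connect (G : stage) w D (x y : G) :
  round G w D -> connect (@adj G) x y.
Proof.
move=> rG; pose d (u v : G) := (~~ connect (@adj G) u v) * D.+1.
have csym : connect_sym (@adj G) by apply/sym_connect_sym/adj_sym.
suff dP : pseudometric (@edge_weight G w) d.
  by have := round_le x y rG dP; rewrite /d; case: connect => //=; lia.
split=> [u|u v|u v z|u v uv]; rewrite /d.
- by rewrite connect0.
- by rewrite csym.
- case uv: (connect _ u v); case vz: (connect _ v z);
    by rewrite ?(connect_trans uv vz) //=; lia.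
- by rewrite connect1.
Qed.

(** [round] is applied to [dist] itself. Conversely, the potential gains at most 1 per step of a
    shortest walk, which exists by connectedness. *)
Lemma diam_eq (G : stage) D : round G 1 D -> stretched G 1 D -> diam G = D.
Proof.
move=> rG [phi [phi1 [x [y xy]]]]; apply/eqP; rewrite eqn_leq.
apply/andP; split.
  apply/bigmax_leqP => u _; apply/bigmax_leqP => v _; apply: round_le rG _.
  have [d0 dC dD d1] := dist_pseudometric G; split=> // a b /d1.
  by rewrite edge_weight1.
have phi1' u v : u -- v -> phi v <= phi u + 1.
  by move=> /phi1; rewrite edge_weight1.
have dxy : dist x y < #|G| by exact/connect_dist/round_connect/rG.
have := lipschitz_walk phi1' (walk_dist dxy) => le.
apply: leq_trans (leq_bigmax x); apply: leq_trans (leq_bigmax y); lia.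
Qed.

(** * Geometry of the even cycle *)

Section Cycle.
Variables (n h : nat).
Hypotheses (n_gt1 : 1 < n) (nE : n = h.*2).

Fact n_gt0 : 0 < n. Proof. exact: ltnW. Qed.

(** Indices are taken modulo [n], so that an arc through node 0 is still an interval of naturals. *)
Definition circ a : cycle_graph n := Ordinal (ltn_pmod a n_gt0).

Lemma circ_val (i : 'I_n) : circ i = i.
Proof. by apply: val_inj; rewrite /= modn_small. Qed.

Lemma circD a : circ (a + n) = circ a.
Proof. by apply: val_inj; rewrite /= modnDr. Qed.

Lemma ordS_circ a : ordS (circ a) = circ a.+1.
Proof. by apply: val_inj; rewrite /= -addn1 modnDml addn1. Qed.

Lemma circ_neqS a : circ a != circ a.+1.
Proof.
apply/eqP => /(congr1 val) /= /eqP.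
rewrite -{1}[a]addn0 -addn1 eqn_modDl !modn_small //; lia.
Qed.

Lemma circ_adj a : circ a -- circ a.+1.
Proof. by rewrite /= /cycle_adj circ_neqS ordS_circ eqxx. Qed.

Lemma cycle_adjP (x y : cycle_graph n) : x -- y ->
  exists i : 'I_n, x = circ i /\ y = circ i.+1 \/ y = circ i /\ x = circ i.+1.
Proof.
by move=> /andP[_ /orP[/eqP->|/eqP->]]; [exists x; left | exists y; right];
  rewrite -ordS_circ circ_val.
Qed.

Lemma circ_shift a (x : cycle_graph n) : exists2 i, i < n & x = circ (a + i).
Proof.
exists ((x + (n - a %% n)) %% n); first by rewrite ltn_mod n_gt0.
have le_an : a %% n <= n by rewrite ltnW // ltn_pmod ?n_gt0.
apply: val_inj; rewrite /= modnDmr -modnDml addnCA (subnKC le_an).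
by rewrite modnDr modn_small.
Qed.

Section Pseudometric.
Variables (w : nat) (d : cycle_graph n -> cycle_graph n -> nat).
Hypothesis dP : pseudometric (fun _ _ => w) d.

Lemma circ_le a b : a <= b -> d (circ a) (circ b) <= w * (b - a).
Proof.
have [d0 dC dD d1] := dP.
move=> /subnK <-; elim: (b - a) => [|k IHk]; first by rewrite add0n d0.
have := dD (circ a) (circ (k + a)) (circ (k.+1 + a)).
have := d1 _ _ (circ_adj (k + a)); rewrite addSn; nia.
Qed.


(** The closed curve is the cycle itself: the two arcs and the two gaps between them have total
    length [w * n]. Lengths [k], [k'] in {0, 1} treat nodes and edges alike. *)
Lemma circ_round i k j k' : k <= 1 -> k' <= 1 -> i < n -> j < n ->
  let: (x, y, p, q) := (circ i, circ (i + k), circ j, circ (j + k')) in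
  d x p + d y q + w * k + w * k' <= w * n \/
  d x q + d y p + w * k + w * k' <= w * n.
Proof.
have [d0 dC dD d1] := dP.
wlog le_ij : i j k k' / i + k <= j \/ i = j /\ k = k'
  => [gen|] k1 k'1 lt_in lt_jn.
  have [ij|ij] : (i + k <= j \/ i = j /\ k = k') \/
                 (j + k' <= i \/ j = i /\ k' = k) by lia.
    exact: gen.
  by case: (gen j i k' k ij) => // le; [left|right];
    move: le; rewrite ![d (circ i) _]dC ![d (circ (i + k)) _]dC; lia.
case: le_ij => [le_ij|[<- <-]]; last by left; rewrite !d0; nia.
right; have le1 : d (circ (i + k)) (circ j) <= w * (j - (i + k)).
  exact: circ_le.
have le2 : d (circ (j + k')) (circ (i + n)) <= w * (i + n - (j + k')).
  by apply: circ_le; lia.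
rewrite dC -(circD i).
have : w * (i + n - (j + k')) + w * (j - (i + k)) + w * k + w * k' = w * n.
  by rewrite -!mulnDr; congr (_ * _); lia.
lia.
Qed.

End Pseudometric.

Lemma arc_shift a w (x y : cycle_graph n) c :
  x = y /\ c = 0 \/ x -- y /\ c = w ->
  exists i k, [/\ i < n, k <= 1, c = w * k
    & x = circ (a + i) /\ y = circ (a + i + k) \/
      y = circ (a + i) /\ x = circ (a + i + k)].
Proof.
case=> [[<- ->]|[/cycle_adjP[j xy] ->]].
  have [i lt_in ->] := circ_shift a x.
  by exists i, 0; rewrite muln0 addn0; split=> //; left.
have [i lt_in ij] := circ_shift a (circ j).
exists i, 1; rewrite muln1 addn1; split=> //.
have -> : circ (a + i).+1 = circ j.+1 by rewrite -ordS_circ -ij ordS_circ.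
by rewrite -ij.
Qed.

Lemma round_cycle w :
  round (@Stage (cycle_graph n) [set: cycle_graph n]) w (h * w).
Proof.
move=> d dP.
have {}dP : pseudometric (fun _ _ : cycle_graph n => w) d.
  by have [d0 dC dD d1] := dP; split=> // x y /d1; rewrite /edge_weight !inE.
have [d0 dC dD d1] := dP.
have arc (x y : cycle_graph n) c :
    segment (G := @Stage (cycle_graph n) [set: cycle_graph n]) w x y c ->
    x = y /\ c = 0 \/ x -- y /\ c = w.
  by case=> [|[[_ _ xy] ->]]; [left | right].
move=> x y c p q c' /arc/(arc_shift 0)[i [k [lt_in k1 -> xy]]].
move=> /arc/(arc_shift 0)[j [k' [lt_jn k'1 -> pq]]].
rewrite !add0n in xy pq; have := circ_round dP k1 k'1 lt_in lt_jn.
rewrite doubleMl -nE [n * w]mulnC.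
by case: xy => -[-> ->]; case: pq => -[-> ->]; lia.
Qed.

Lemma stretched_cycle w :
  stretched (@Stage (cycle_graph n) [set: cycle_graph n]) w (h * w).
Proof.
(* The potential is [w] times the hop distance from node 0, largest at the antipode [h]. *)
exists (fun x : 'I_n => minn x (n - x) * w); split=> [x y|]; last first.
  exists (circ 0), (circ h); rewrite /= mod0n modn_small; last lia.
  by rewrite nE -addnn addnK minnn; lia.
rewrite /edge_weight !inE -mulSnr leq_mul2r => /cycle_adjP[i xy].
have [lt_in|] := ltnP i.+1 n.
  by case: xy => -[-> ->] /=; rewrite !modn_small //; lia.
rewrite leq_eqVlt ltnNge ltn_ord orbF => /eqP ni.
by case: xy => -[-> ->] /=; rewrite -ni modnn modn_small //; lia.
Qed.

Lemma diam_cycle : diam (cycle_graph n) = h.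
Proof.
rewrite -[h]muln1.
exact: (diam_eq (@round_cycle 1) (stretched_cycle 1)).
Qed.

(* The node or edge xy lies on a geodesic between the antipodal nodes p, q.   *)
Lemma diametral_arc w d (p q x y : cycle_graph n) c :
  pseudometric (fun _ _ => w) d -> dist p q = h ->
  x = y /\ c = 0 \/ x -- y /\ c = w ->
  d p x + c + d y q <= h * w \/ d p y + c + d x q <= h * w.
Proof.
move=> dP pq; have [d0 dC dD d1] := dP.
have [a pa] : exists a, p = circ a by exists p; rewrite circ_val.
subst p.
have [i0 lt_i0n q_i0] := circ_shift a q.
(* Both arcs from [p] to [q] have length at least [h] and together [2 * h], so [q] is antipodal to
   [p]. *)
have {q_i0} ? : q = circ (a + h); last subst q.
  rewrite q_i0; congr (circ (_ + _)).
  have dist1 := dist_pseudometric (cycle_graph n); have [_ distC _ _] := dist1.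
  have le1 : h <= i0.
    rewrite -pq q_i0; have /(circ_le dist1) : a <= a + i0 by exact: leq_addr.
    by rewrite mul1n addKn.
  have le2 : h <= n - i0.
    rewrite -pq q_i0 distC -[circ a]circD.
    have /(circ_le dist1) : a + i0 <= a + n by lia.
    by rewrite mul1n subnDl.
  lia.
move=> /(arc_shift a)[i [k [lt_in k1 -> xy]]].
suff : d (circ a) (circ (a + i)) + w * k + d (circ (a + i + k)) (circ (a + h))
         <= h * w \/
       d (circ a) (circ (a + i + k)) + w * k + d (circ (a + i)) (circ (a + h))
         <= h * w.
  by case: xy => -[-> ->]; lia.
(* The geodesic is whichever half of the cycle contains the arc. *)
have [le_ikh|lt_hik] := leqP (i + k) h; [left | right].
  have /(circ_le dP) : a <= a + i by exact: leq_addr.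
  have /(circ_le dP) : a + i + k <= a + h by lia.
  have : w * (a + i - a) + w * k + w * (a + h - (a + i + k)) = h * w.
    by rewrite -!mulnDr mulnC; congr (_ * _); lia.
  lia.
have /(circ_le dP) : a + h <= a + i by lia.
have /(circ_le dP) : a + i + k <= a + n by lia.
rewrite circD [d (circ a) _]dC [d (circ (a + h)) _]dC.
have : w * (a + i - (a + h)) + w * k + w * (a + n - (a + i + k)) = h * w.
  by rewrite -!mulnDr mulnC; congr (_ * _); lia.
lia.
Qed.

End Cycle.

(** * Subgraphs isomorphic to the cycle *)

Lemma set2_inj (T : finType) (x y u v : T) :
  [set x; y] = [set u; v] -> x = u /\ y = v \/ x = v /\ y = u.
Proof.
move=> E; have /set2P xuv : x \in [set u; v] by rewrite -E set21.
have /set2P yuv : y \in [set u; v] by rewrite -E set22.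
have /set2P uxy : u \in [set x; y] by rewrite E set21.
have /set2P vxy : v \in [set x; y] by rewrite E set22.
by intuition congruence.
Qed.

Lemma edgesP (G : sgraph) (e : {set G}) :
  reflect (exists x y, x -- y /\ e = [set x; y]) (e \in edges G).
Proof.
apply: (iffP imset2P) => [[x y _]|[x [y [xy ->]]]].
  by rewrite !inE => xy ->; exists x, y.
by exists x y; rewrite ?inE.
Qed.

(** This is what makes the set of substituted edges exactly the set of fresh edges, see
    [rrgg_step_edges]. *)
Definition covered (Q : sgraph) (G : stage) : Prop :=
  forall x y : G, fresh_edge x y ->
  exists (W : {set G}) (F : {set {set G}}),
    [/\ is_subgraph (fresh G) W F, subgraph_iso Q W F & [set x; y] \in F].

(** The subgraph keeps only the images of edges of [Q], so [f] need not reflect adjacency. *)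
Lemma embedding_cover (Q : sgraph) (G : stage) (f : Q -> G) x y :
  injective f -> (forall a, f a \in fresh G) ->
  (forall a b, a -- b -> f a -- f b) -> x -- y ->
  exists (W : {set G}) (F : {set {set G}}),
    [/\ is_subgraph (fresh G) W F, subgraph_iso Q W F & [set f x; f y] \in F].
Proof.
move=> f_inj f_fresh f_adj xy.
exists (f @: setT), [set [set f a; f b] | a in Q, b in Q & a -- b]; split.
- split; first by apply/subsetP => _ /imsetP[a _ ->].
    apply/subsetP => _ /imset2P[a b _ + ->]; rewrite inE /= => ab.
    by apply/edgesP; exists (f a), (f b); split; first exact: f_adj.
  move=> _ /imset2P[a b _ _ ->].
  by apply/subsetP => z /set2P[] ->; apply: imset_f.
- exists f; split=> // u v; apply/idP/imset2P => [uv|[a b _]].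
    by exists u v; rewrite ?inE.
  rewrite inE /= => ab /set2_inj[][/f_inj -> /f_inj ->] //.
  by rewrite adj_sym.
- by apply/imset2P; exists x y; rewrite ?inE.
Qed.

Lemma covered_self (H : sgraph) : covered H (@Stage H [set: H]).
Proof.
move=> x y [_ _ xy].
by apply: (@embedding_cover H (@Stage H [set: H]) id) => // a; rewrite inE.
Qed.

(** * One substitution step preserves the certificates *)

Section Step.
Variables (G : stage) (n h : nat) (S : {set {set G}}).
Hypotheses (n_gt1 : 1 < n) (nE : n = h.*2).
Variable port : {e : {set G} | e \in S} -> G -> cycle_graph n.
Hypothesis SP :
  forall e, e \in S <-> exists x y : G, fresh_edge x y /\ e = [set x; y].
Hypothesis portP : diametral_ports port.

Notation copy := {e : {set G} | e \in S}.
Notation G' := (@Stage (subst_edges port) [set a | ~~ is_inl a]).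

(** A connecting edge has an old endpoint, so every fresh edge lies inside one copy. *)
Lemma covered_subst : covered (cycle_graph n) G'.
Proof.
move=> [u|[e x]] [v|[f y]] []; rewrite ?inE //= => _ _ /andP[/eqP <- xy].
apply: (@embedding_cover _ G' (fun a => inr (e, a))) => // [a b []|a|a b ab] //.
  by rewrite inE.
by rewrite /= eqxx.
Qed.

Lemma substP (e : copy) :
  exists u v, fresh_edge u v /\ val e = [set u; v].
Proof. exact/SP/valP. Qed.

Lemma subst_edgeP (e : copy) u v :
  u \in val e -> v \in val e -> u != v -> fresh_edge u v /\ val e = [set u; v].
Proof.
have [u' [v' [uv ->]]] := substP e.
move=> /set2P[]-> /set2P[]->; rewrite ?eqxx // => _.
by split; [exact: fresh_edge_sym | rewrite setUC].
Qed.

Lemma dist_port (e : copy) u v :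
  val e = [set u; v] -> dist (port e u) (port e v) = h.
Proof. by move=> /portP ->; apply: diam_cycle. Qed.

Lemma round_subst w D : round G (h * w + 2) D -> round G' w D.
Proof.
move=> rG d [d0 dC dD d1]; pose dG (u v : G) := d (inl u) (inl v).
have dport (e : copy) u : u \in val e -> d (inl u) (inr (e, port e u)) <= 1.
  move=> ue; have := d1 (inl u) (inr (e, port e u)).
  by rewrite /= ue eqxx /edge_weight !inE; apply.
have dnear (e : copy) u x : u \in val e ->
    d (inl u) (inr (e, x)) <= d (inr (e, port e u)) (inr (e, x)) + 1.
  move=> /dport ue; have := dD (inl u) (inr (e, port e u)) (inr (e, x)); lia.
have dcopy (e : copy) :
    pseudometric (fun _ _ => w) (fun x y => d (inr (e, x)) (inr (e, y))).
  split=> // x y xy; have /d1 : (inr (e, x) : G') -- inr (e, y) by apply/andP.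
  by rewrite /edge_weight !inE.
(* Each segment of the new graph sits on a path between old vertices [u], [v] no longer than the old
   segment [uv]: two connecting edges plus a geodesic between the ports. *)
have contained a b c : segment (G := G') w a b c ->
    exists u v C, segment (h * w + 2) u v C /\
      d (inl u) a + c + d (inl v) b <= C.
  case: a => [u|[e x]].
    case=> [[<- ->]|[[]]]; last by rewrite inE.
    by exists u, u, 0; rewrite d0; split=> //; left.
  move=> xyc; have [u [v [uv euv]]] := substP e.
  suff : d (inl u) (inr (e, x)) + c + d (inl v) b <= h * w + 2 \/
         d (inl u) b + c + d (inl v) (inr (e, x)) <= h * w + 2.
    case=> ?; [exists u, v | exists v, u];
      exists (h * w + 2); split=> //;
      try by right; split=> //; apply: fresh_edge_sym.
    by rewrite addnC [_ + c]addnC addnA.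
  have [y [xyc' ->]] :
      exists y, (x = y /\ c = 0 \/ x -- y /\ c = w) /\ b = inr (e, y).
    case: xyc => [[<- ->]|[[_]]]; first by exists x; split; [left|].
    case: b => [v'|[f y]]; rewrite inE //= => _ /andP[/eqP <- xy] ->.
    by exists y; split; [right|].
  have := diametral_arc n_gt1 nE (dcopy e) (dist_port euv) xyc'.
  have ue : u \in val e by rewrite euv set21.
  have ve : v \in val e by rewrite euv set22.
  have add_ends k r t : r + c + t <= k -> (r + 1) + c + (t + 1) <= k + 2 by lia.
  case=> xy; [left | right]; (apply: leq_trans (add_ends _ _ _ xy));
    by rewrite !leq_add ?dnear // [X in _ <= X + 1]dC dnear.
have dGP : pseudometric (@edge_weight G (h * w + 2)) dG.
  split=> [u|u v|u v z|u v uv]; rewrite /dG //.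
  have [uvS|uvS] := boolP ([set u; v] \in S).
    have [u' [v' [[fu' fv' _] uvE]]] := (SP _).1 uvS.
    rewrite /edge_weight; have -> : (u \in fresh G) && (v \in fresh G).
      by have [[-> ->]|[-> ->]] := set2_inj uvE; rewrite fu' fv'.
    pose e : copy := exist (fun f : {set G} => f \in S) _ uvS.
    have dpq : d (inr (e, port e u)) (inr (e, port e v)) <= h * w.
      have := diametral_arc n_gt1 nE (dcopy e) (dist_port (erefl (val e)))
        (or_introl (conj (erefl (port e v)) (erefl 0))).
      by rewrite d0 !addn0; case.
    apply: leq_trans (dD _ (inr (e, port e v)) _) _.
    rewrite [d _ (inl v)]dC (addnA (h * w) 1 1); apply: leq_add.
      apply: leq_trans (dnear e u (port e v) (set21 u v)) _.
      by rewrite leq_add2r.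
    by apply: dport; rewrite set22.
  have uv' : (inl u : G') -- inl v by apply/andP.
  have := d1 _ _ uv'; rewrite /edge_weight !inE => /leq_trans; apply.
  case: ifP => // /andP[fu fv]; case/negP: uvS.
  by apply/SP; exists u, v.
move=> a b c p q c' /contained[u [v [C [uvC abC]]]].
move=> /contained[u' [v' [C' [uvC' pqC]]]].
have := rG dG dGP _ _ _ _ _ _ uvC uvC'; rewrite /dG.
(* Rerouting: the closed curve through [uv] and [u'v'] is made to pass through the new segments by
   detours already paid for in [C] and [C']. *)
have far (y z t s : G') : d t s <= d y t + d y z + d z s.
  have := dD t y s; have := dD y z s; rewrite [d t y]dC; lia.
have := far (inl u) (inl u') a p; have := far (inl v) (inl v') b q.
have := far (inl u) (inl v') a q; have := far (inl v) (inl u') b p.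
lia.
Qed.

Lemma stretched_subst w D : stretched G (h * w + 2) D -> stretched G' w D.
Proof.
move=> [phi [phi1 [x [y xy]]]].
(* McShane's extension; the subtraction truncates at 0, which preserves the   *)
(* Lipschitz condition.                                                       *)
pose psi (a : G') := match a with
  | inl u => phi u
  | inr (e, x) => \max_(u in val e) (phi u - 1 - w * dist (port e u) x)
  end.
exists psi; split; last by exists (inl x), (inl y).
have [dist0 distC distD dist1] := dist_pseudometric (cycle_graph n).
have psi_ge (e : copy) a u : u \in val e ->
    phi u - 1 - w * dist (port e u) a <= psi (inr (e, a)).
  by move=> ue; apply: leq_bigmax_cond ue.
have psi_port (e : copy) u : u \in val e ->
    psi (inr (e, port e u)) <= phi u + 1 /\
    phi u <= psi (inr (e, port e u)) + 1.
  move=> ue; split; last first.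
    have := psi_ge e (port e u) u ue.
    by rewrite dist0 muln0 subn0 leq_subLR addnC.
  (* The other endpoint [v] of [e] contributes [phi v - 1 - w * h], and [phi v] exceeds [phi u] by
     at most [h * w + 2], leaving the allowed 1. *)
  apply/bigmax_leqP => v ve; have [->|neq_vu] := eqVneq v u; first lia.
  have [[fv fu vu] euv] := subst_edgeP ve ue neq_vu.
  rewrite (dist_port euv); have := phi1 u v.
  by rewrite adj_sym /edge_weight fu fv /= => /(_ vu); lia.
have psi_copy (e : copy) a b :
    a -- b -> psi (inr (e, a)) <= psi (inr (e, b)) + w.
  move=> ab; apply/bigmax_leqP => u ue.
  have := psi_ge e b u ue; have := distD (port e u) a b; have := dist1 _ _ ab.
  nia.
move=> [u|[e a]] [v|[f b]]; rewrite /edge_weight !inE.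
- move=> /= /andP[uv uvS]; have := phi1 _ _ uv; rewrite /edge_weight.
  case: ifP => // /andP[fu fv]; case/negP: uvS.
  by apply/SP; exists u, v.
- by move=> /= /andP[/psi_port[? _] /eqP ->].
- by move=> /= /andP[/psi_port[_ ?] /eqP ->].
- by move=> /= /andP[/eqP <- ?]; apply: psi_copy; rewrite adj_sym.
Qed.

End Step.

(** * Induction over the stages *)

Lemma rrgg_step_edges n (G : stage) (S : {set {set G}}) :
  covered (cycle_graph n) G ->
  (forall e, e \in S <->
     exists (Q : sgraph) (W : {set G}) (F : {set {set G}}),
       [/\ Q = cycle_graph n, is_subgraph (fresh G) W F, subgraph_iso Q W F
         & e \in F]) ->
  forall e, e \in S <-> exists x y : G, fresh_edge x y /\ e = [set x; y].
Proof.
move=> cG SP e; split=> [/SP[Q [W [F [_ [WA FE FW] _ eF]]]]|[x [y [xy ->]]]].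
  have /edgesP[x [y [xy exy]]] := subsetP FE e eF.
  have /subsetP eA := subset_trans (FW e eF) WA.
  by exists x, y; split=> //; split=> //;
    apply: eA; rewrite exy !inE eqxx ?orbT.
have [W [F [sWF iWF xyF]]] := cG x y xy; apply/SP.
by exists (cycle_graph n), W, F.
Qed.

(** The length [w] is quantified inside the induction, since stage [l.+1] at [w] calls on stage [l]
    at [h * w + 2]. *)
Lemma rrgg_invariant n h (G : nat -> stage) :
  1 < n -> n = h.*2 ->
  rrgg (cycle_graph n) (cycle_graph n) (fun Q => Q = cycle_graph n) G ->
  forall l w, let D := h * iter l (fun k => h * k + 2) w in
  [/\ covered (cycle_graph n) (G l), round (G l) w D & stretched (G l) w D].
Proof.
move=> n_gt1 nE [G0 Gstep]; elim=> [|l IHl] w.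
  rewrite /= G0; split; first exact: covered_self.
    exact: round_cycle.
  exact: stretched_cycle.
have [cG rG sG] := IHl (h * w + 2).
have [S [port [SP portP ->]]] := Gstep l.
have {}SP := rrgg_step_edges cG SP.
rewrite iterSr; split.
- exact: covered_subst.
- exact: round_subst SP portP _ _ rG.
- exact: stretched_subst SP portP _ _ sG.
Qed.

Theorem lemma5 (m n : nat) (G : nat -> stage) (l : nat) :
  n = 2 ^ m -> 4 <= n ->
  rrgg (cycle_graph n) (cycle_graph n) (fun Q => Q = cycle_graph n) G ->
  1 <= l ->
  diam (G l) = diam (G 0) * (diam (G l.-1) + 2).
Proof.
move=> n2m n_ge4 rrggG; case: l => // l _.
have nE : n = (2 ^ m.-1).*2.
  rewrite n2m; case: m n2m => [n1|k _]; first by rewrite n1 in n_ge4.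
  by rewrite expnS mul2n.
have n_gt1 : 1 < n by apply: leq_trans n_ge4.
have diamE k : diam (G k) = 2 ^ m.-1 * iter k (fun w => 2 ^ m.-1 * w + 2) 1.
  by have [_ rG sG] := rrgg_invariant n_gt1 nE rrggG k 1; apply: diam_eq.
by rewrite !diamE /= muln1.
Qed.
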